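(* Let $n\ge 3$, $S=\mathbb{C}[x_1,\dots,x_n]$, $a\in\mathbb{N}$, and let $m$ be a positive integer with $m<n-1$. Then the ideal $I=\langle p_a,p_{2a},\dots,p_{ma}\rangle$ is a prime ideal of $S$.
   Context: $p_d=\sum_{i=1}^n x_i^d$ denotes the power sum symmetric polynomial of degree $d$; $\mathbb{N}$ is the set of positive integers. *)

(* Defs.v *)
From HB Require Import structures.
From mathcomp Require Import all_boot all_order all_algebra.
Set Implicit Arguments. Unset Strict Implicit. Unset Printing Implicit Defensive.
Import Order.TTheory GRing.Theory Num.Theory.
Local Open Scope ring_scope.

Fixpoint mpoly (C : comNzRingType) (n : nat) : comNzRingType :=
  if n is k.+1 then {poly mpoly C k} : comNzRingType else C.

(* the variable x_i (0-based, i < n) of mpoly C n; 0 if i >= n (never used) *)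
Fixpoint mvar (C : comNzRingType) (n : nat) (i : nat) : mpoly C n :=
  match n return mpoly C n with
  | 0 => 0
  | k.+1 => if i == k then ('X : {poly mpoly C k}) else ((mvar C k i)%:P : {poly mpoly C k})
  end.

Definition psum (C : comNzRingType) (n d : nat) : mpoly C n :=
  \sum_(i < n) mvar C n i ^+ d.

Definition in_ideal_gen (R : comNzRingType) (k : nat) (g : 'I_k -> R) (f : R) : Prop :=
  exists r : 'I_k -> R, f = \sum_(i < k) r i * g i.

Definition prime_ideal (R : comNzRingType) (I : R -> Prop) : Prop :=
  [/\ I 0,
      (forall a b, I a -> I b -> I (a + b)),
      (forall a b, I b -> I (a * b)),
      ~ I 1 &
      (forall a b, I (a * b) -> I a \/ I b)].

(* Main.v *)
Require Import Defs.
From HB Require Import structures.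
From mathcomp Require Import all_boot all_order all_algebra.
From mathcomp Require Import perm separable ring zify.
From Stdlib Require Import Classical.
Import Order.TTheory GRing.Theory Num.Theory.
Local Open Scope ring_scope.

Set Implicit Arguments. Unset Strict Implicit. Unset Printing Implicit Defensive.

(** Put [k = n - m >= 2] and [y_i = x_i ^ a].  By Newton's identities [I] is
    generated by the complete homogeneous polynomials
    [h_(n - j) (y_0, ..., y_j)], [k <= j < n], each monic in [x_j]; hence [S / I]
    is free over [A = C[x_0, ..., x_(k-1)]], and a polynomial outside [I] takes a
    nonzero value somewhere on the fibre of [V(I)] over a generic point of [A].

    The group of permutations of [x_k, ..., x_(n-1)] and scalings of these by
    [a]-th roots of unity is transitive on these fibres, and it is generated
    by reflections.  If [s] is a reflection with linear form [l], then
    [u * s(u)] in [I] forces [u] in [I]: as [l] divides [u - s(u)], the square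
    [u ^ 2] lies in [(I, l)], which is radical, so [u = l v] modulo [I], where
    [v * s(v)] is again in [I] because [l] is regular modulo [I]; iterating, [u]
    lies in every [I + (l ^ j)], hence in [I].  Moving [l] by a permutation of
    the variables we may take it in [A], where regularity and separation follow
    from freeness and where radicality holds because the fibre over a generic
    point of [l = 0] is still reduced.

    Consequently, for [u] outside [I] the product of the translates of [u] is
    outside [I], so [u] vanishes nowhere on the generic fibres of [V(I)]; this
    makes the product of two polynomials outside [I] nonzero somewhere on [V(I)]. *)

(** * Ideals as predicates *)

Record ideal (R : comNzRingType) (J : R -> Prop) : Prop := Ideal {
  ideal_zero : J 0;
  ideal_add : forall x y, J x -> J y -> J (x + y);
  ideal_mul : forall x y, J y -> J (x * y) }.

Section Ideals.
Variables (R : comNzRingType) (J : R -> Prop).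
Hypothesis idJ : ideal J.

Lemma ideal_mulr x y : J x -> J (x * y).
Proof. by rewrite mulrC; apply: ideal_mul. Qed.

Lemma ideal_opp x : J x -> J (- x).
Proof. by rewrite -mulN1r; apply: ideal_mul. Qed.

Lemma ideal_sub x y : J x -> J y -> J (x - y).
Proof. by move=> Jx Jy; apply: ideal_add => //; apply: ideal_opp. Qed.

Lemma ideal_sum I (s : seq I) (P : pred I) (F : I -> R) :
  (forall i, P i -> J (F i)) -> J (\sum_(i <- s | P i) F i).
Proof. by move=> JF; apply: big_ind => //; [apply: ideal_zero | apply: ideal_add]. Qed.

Lemma ideal_map_poly : ideal (fun p : {poly R} => forall i, J p`_i).
Proof.
split=> [i|p q Jp Jq i|p q Jq i]; rewrite ?coef0 ?coefD ?coefM.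
- exact: ideal_zero.
- exact: ideal_add.
- by apply: ideal_sum => j _; apply: ideal_mul.
Qed.

End Ideals.

Lemma ideal_eq0 (R : comNzRingType) : ideal (fun x : R => x = 0).
Proof. by split=> // [x y -> ->|x y ->]; rewrite ?addr0 ?mulr0. Qed.

Lemma ideal_in_gen (R : comNzRingType) k (g : 'I_k -> R) :
  ideal (in_ideal_gen g).
Proof.
split=> [|x y [r ->] [s ->]|x y [r ->]].
- by exists (fun=> 0); rewrite big1 // => i _; rewrite mul0r.
- exists (fun i => r i + s i); rewrite -big_split /=.
  by apply: eq_bigr => i _; rewrite mulrDl.
- exists (fun i => x * r i); rewrite mulr_sumr.
  by apply: eq_bigr => i _; rewrite mulrA.
Qed.

Lemma gen_in_ideal (R : comNzRingType) k (g : 'I_k -> R) i :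
  in_ideal_gen g (g i).
Proof.
exists (fun j => (j == i)%:R); rewrite (bigD1 i) //= eqxx mul1r big1 ?addr0 //.
by move=> j /negPf->; rewrite mul0r.
Qed.

Lemma in_gen_sub (R : comNzRingType) (J : R -> Prop) k (g : 'I_k -> R) f :
  ideal J -> (forall i, J (g i)) -> in_ideal_gen g f -> J f.
Proof.
by move=> idJ Jg [r ->]; apply: ideal_sum => // i _; apply: ideal_mul.
Qed.

(** * Division by a monic polynomial modulo an ideal of coefficients *)

Section MonicDivision.
Variables (R : comNzRingType) (J : R -> Prop) (g : {poly R}).
Hypotheses (idJ : ideal J) (mg : g \is monic).

Lemma rmodp_coef_ideal (p : {poly R}) :
  (forall i, J p`_i) -> forall i, J (Pdiv.Ring.rmodp p g)`_i.
Proof.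
move=> Jp i; rewrite -(coefK p) poly_def Pdiv.RingMonic.rmodp_sum // coef_sum.
apply: ideal_sum => // j _; rewrite Pdiv.RingMonic.rmodpZ // coefZ mulrC.
by apply: ideal_mul => //; apply: Jp.
Qed.

(** Both sides have the same remainder modulo [g]. On the left it is the remainder of [r1], which
    depends linearly on [r1] and so keeps its coefficients in [J]. *)
Lemma remainder_coef_ideal (q1 q2 r1 r2 : {poly R}) :
    q1 * g + r1 = q2 * g + r2 -> (size r2 < size g)%N ->
  (forall i, J r1`_i) -> forall i, J r2`_i.
Proof.
move=> eqf lt_r2 /rmodp_coef_ideal Jr1 i.
rewrite -(Pdiv.RingMonic.rmodp_addl_mul_small mg q2 lt_r2) -eqf.
by rewrite Pdiv.RingMonic.rmodpD // Pdiv.RingMonic.rmodp_mull // add0r.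
Qed.

Lemma monic_division (f : {poly R}) :
  exists q r, f = q * g + r /\ (size r < size g)%N.
Proof.
exists (Pdiv.Ring.rdivp f g), (Pdiv.Ring.rmodp f g).
split; first exact: Pdiv.RingMonic.rdivp_eq.
by rewrite Pdiv.Ring.ltn_rmodpN0 // monic_neq0.
Qed.

End MonicDivision.

(** * Evaluation morphisms on iterated polynomial rings *)

Section Evaluation.
Variables (C R : comNzRingType) (iota : {rmorphism C -> R}).

(** The target ring and [iota] are left free, so that one definition serves for evaluation at points
    of [C], for substitutions and for inclusions of polynomial rings. *)
Fixpoint mev (s : nat -> R) (n : nat) : {rmorphism mpoly C n -> R} :=
  match n return {rmorphism mpoly C n -> R} with
  | 0 => iota
  | k.+1 => horner_morph (fun x => mulrC (s k) (mev s k x))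
  end.

Lemma mevS s n (p : {poly mpoly C n}) :
  mev s n.+1 p = (map_poly (mev s n) p).[s n].
Proof. by []. Qed.

Lemma mev_polyC s n (c : mpoly C n) :
  mev s n.+1 (c%:P : {poly _}) = mev s n c.
Proof. by rewrite mevS map_polyC hornerC. Qed.

Lemma mev_var s n i : (i < n)%N -> mev s n (mvar C n i) = s i.
Proof.
elim: n => // n IHn; rewrite ltnS leq_eqVlt => /predU1P[->|lt_in].
  by rewrite [mvar _ _ _]/= eqxx mevS map_polyX hornerX.
by rewrite [mvar _ _ _]/= (ltn_eqF lt_in) mev_polyC IHn.
Qed.

Fixpoint mcst (n : nat) : {rmorphism C -> mpoly C n} :=
  match n return {rmorphism C -> mpoly C n} with
  | 0 => idfun
  | k.+1 => (polyC : mpoly C k -> {poly mpoly C k}) \o mcst k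
  end.

Lemma mev_cst s n c : mev s n (mcst n c) = iota c.
Proof. by elim: n => // n IHn; rewrite [mcst _ _]/= mev_polyC. Qed.

End Evaluation.

Lemma mvar_lt (C : comNzRingType) n i : (i < n)%N ->
  mvar C n.+1 i = ((mvar C n i)%:P : {poly mpoly C n}).
Proof. by move=> lt_in /=; rewrite (ltn_eqF lt_in). Qed.

Lemma mvar_last (C : comNzRingType) n :
  mvar C n.+1 n = ('X : {poly mpoly C n}).
Proof. by rewrite /= eqxx. Qed.

(** With [J] zero this is the uniqueness of evaluation morphisms; with [J] principal it shows that a
    linear form divides [u - s(u)] as soon as it does so for the variables. *)
Lemma mpoly_morph_cong (C R : comNzRingType) n (f g : {rmorphism mpoly C n -> R})
    (J : R -> Prop) : ideal J ->
    (forall c, f (mcst C n c) = g (mcst C n c)) ->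
    (forall i, (i < n)%N -> J (f (mvar C n i) - g (mvar C n i))) ->
  forall u, J (f u - g u).
Proof.
move=> idJ; elim: n => [|n IHn] in f g * => eq_cst J_var.
  by move=> u; rewrite [f u]eq_cst subrr; apply: ideal_zero.
have JC c : J (f (c%:P : {poly _}) - g (c%:P : {poly _})).
  pose f' : {rmorphism mpoly C n -> R} := f \o (polyC : _ -> {poly _}).
  pose g' : {rmorphism mpoly C n -> R} := g \o (polyC : _ -> {poly _}).
  apply: (IHn f' g') => [d|i lt_in]; first exact: eq_cst.
  by have := J_var i (ltnW lt_in); rewrite mvar_lt.
elim/poly_ind => [|p c IHp]; first by rewrite !rmorph0 subrr; apply: ideal_zero.
rewrite !rmorphD !rmorphM /= opprD addrACA; apply: ideal_add => //.
set x := f 'X; set y := g 'X; set u := f p; set v := g p.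
have -> : u * x - v * y = x * (u - v) + v * (x - y).
  by rewrite !mulrBr [x * u]mulrC [x * v]mulrC addrA subrK.
apply: ideal_add => //; apply: ideal_mul => //.
by have := J_var n (ltnSn n); rewrite mvar_last.
Qed.

Lemma mpoly_morph_ext (C R : comNzRingType) n (f g : {rmorphism mpoly C n -> R}) :
    (forall c, f (mcst C n c) = g (mcst C n c)) ->
    (forall i, (i < n)%N -> f (mvar C n i) = g (mvar C n i)) ->
  f =1 g.
Proof.
move=> eq_cst eq_var u; apply/subr0_eq.
apply: (mpoly_morph_cong (ideal_eq0 R)) => // i lt_in.
by rewrite eq_var ?subrr.
Qed.

Lemma eq_mev (C R : comNzRingType) (iota : {rmorphism C -> R}) s1 s2 n :
  (forall i, (i < n)%N -> s1 i = s2 i) -> mev iota s1 n =1 mev iota s2 n.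
Proof.
move=> eq_s; apply: mpoly_morph_ext => [c|i lt_in]; first by rewrite !mev_cst.
by rewrite !mev_var ?eq_s.
Qed.

(** * Nonzero polynomials have nonzero values *)

Section Density.
Variable C : numClosedFieldType.

(** [mpoly] carries only a ring structure, so the domain property is proved along its recursion,
    through leading coefficients. *)
Lemma mpoly_mul_neq0 n (f g : mpoly C n) : f <> 0 -> g <> 0 -> f * g <> 0.
Proof.
elim: n f g => [|n IHn] f g.
  by move=> /eqP f0 /eqP g0; apply/eqP; rewrite mulf_neq0.
move=> /eqP f0 /eqP g0 fg0.
have := @lead_coef_proper_mul (mpoly C n) f g.
rewrite -[f * g]/(f * g : mpoly C n.+1) fg0 lead_coef0.
have nz : lead_coef (f : {poly _}) * lead_coef (g : {poly _}) != 0.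
  by apply/eqP/IHn; apply/eqP; rewrite lead_coef_eq0.
by move=> /(_ nz) /esym/eqP; apply/negP.
Qed.

Lemma poly_nonroot (p : {poly C}) : p != 0 -> exists z, p.[z] != 0.
Proof.
move=> p0; pose s : seq C := [seq i%:R | i <- iota 0 (size p)].
have [/(max_poly_roots p0)|/allPn[z _]] := boolP (all (root p) s); last by exists z.
rewrite map_inj_uniq ?iota_uniq //; first by rewrite size_map size_iota ltnn => /(_ isT).
by move=> i j /eqP; rewrite eqr_nat => /eqP.
Qed.

Lemma mpoly_nonvanish n (f : mpoly C n) :
  f <> 0 -> exists w : nat -> C, mev idfun w n f != 0.
Proof.
elim: n f => [f /eqP|n IHn f /eqP f0]; first by exists (fun=> 0).
have [i fi0] : exists i, (f : {poly _})`_i <> 0.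
  by exists (size (f : {poly _})).-1; apply/eqP; rewrite -lead_coefE lead_coef_eq0.
have [w wfi] := IHn _ fi0.
have [|z wz] := @poly_nonroot (map_poly (mev idfun w n) (f : {poly _})).
  by apply: contraNneq wfi => /(congr1 (coefp i)) /=; rewrite coef_map coef0 => ->.
exists (fun j => if j == n then z else w j); rewrite mevS eqxx.
rewrite (_ : map_poly _ _ = map_poly (mev idfun w n) (f : {poly _})) //.
apply/polyP => j; rewrite !coef_map /=; apply: eq_mev => l lt_ln.
by rewrite (ltn_eqF lt_ln).
Qed.

End Density.

(** * Complete homogeneous symmetric polynomials and Newton's identities *)

Section CompleteSymmetric.
Variable R : comNzRingType.
Implicit Type y : nat -> R.

(* [hsym y j r] is the complete homogeneous symmetric polynomial of degree [r]
   in [y 0, ..., y (j - 1)]. *)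
Fixpoint hsym y (j r : nat) : R :=
  match j with
  | 0 => (r == 0)%:R
  | j'.+1 => \sum_(i < r.+1) y j' ^+ i * hsym y j' (r - i)
  end.

#[global] Arguments hsym : simpl never.

(* The same polynomial in the [j + 1] quantities [y 0, ..., y (j - 1), Y]. *)
Definition hstep y j r Y := \sum_(i < r.+1) Y ^+ i * hsym y j (r - i).

Lemma hstep_hsym y j r : hstep y j r (y j) = hsym y j.+1 r.
Proof. by []. Qed.

Lemma hstepS y j r Y : hstep y j r.+1 Y = hsym y j r.+1 + Y * hstep y j r Y.
Proof.
rewrite /hstep big_ord_recl mul1r subn0 mulr_sumr; congr (_ + _).
by apply: eq_bigr => i _; rewrite mulrA -exprS.
Qed.

Lemma hsymS y j r :
  hsym y j.+1 r.+1 = hsym y j r.+1 + y j * hsym y j.+1 r.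
Proof. exact: hstepS. Qed.

Lemma hsym_deg0 y j : hsym y j 0 = 1.
Proof. by elim: j => // j IHj; rewrite -hstep_hsym /hstep big_ord1 mul1r. Qed.

Lemma hstep_deg0 y j Y : hstep y j 0 Y = 1.
Proof. by rewrite /hstep big_ord1 mul1r hsym_deg0. Qed.

Lemma eq_hsym y1 y2 j r :
  (forall i, (i < j)%N -> y1 i = y2 i) -> hsym y1 j r = hsym y2 j r.
Proof.
elim: j r => // j IHj r eq_y; rewrite -!hstep_hsym; apply: eq_bigr => i _.
by rewrite eq_y ?IHj // => l /ltnW; apply: eq_y.
Qed.

Lemma eq_hstep y1 y2 j r Y :
  (forall i, (i < j)%N -> y1 i = y2 i) -> hstep y1 j r Y = hstep y2 j r Y.
Proof. by move=> eq_y; apply: eq_bigr => i _; rewrite (eq_hsym _ eq_y). Qed.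

(* Newton's divided differences. *)
Lemma hstep_factor y j r Y :
  hstep y j r.+1 Y = hsym y j.+1 r.+1 + (Y - y j) * hstep y j.+1 r Y.
Proof.
elim: r => [|r IHr].
  by rewrite hsymS hstepS !hstep_deg0 !hsym_deg0; ring.
rewrite hstepS IHr [in RHS]hsymS [in RHS]hstepS; ring.
Qed.

(** Splitting off [y j], the right side for [j.+1] and [r.+1] becomes the one for [j] and [r.+1],
    plus [y j] times the one for [j.+1] and [r], plus [y j * hsym y j.+1 r]; hence the double
    induction. *)
Lemma hsym_newton y j r :
  r%:R * hsym y j r =
  \sum_(i < r) (\sum_(l < j) y l ^+ i.+1) * hsym y j (r - i.+1).
Proof.
elim: j r => [|j IHj] r.
  rewrite big1 => [|i _]; last by rewrite big_ord0 mul0r.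
  by case: r => [|r]; rewrite /hsym ?mul0r ?mulr0.
elim: r => [|r IHr]; first by rewrite big_ord0 mul0r.
rewrite (eq_bigr (fun i : 'I_r.+1 =>
    (\sum_(l < j) y l ^+ i.+1) * hsym y j.+1 (r - i)
    + y j ^+ i.+1 * hsym y j.+1 (r - i))); last first.
  by move=> i _; rewrite big_ord_recr /= mulrDl subSS.
rewrite big_split /= [X in X + _]big_ord_recr [X in _ + X]big_ord_recl /=.
rewrite (eq_bigr (fun i : 'I_r =>
    (\sum_(l < j) y l ^+ i.+1) * hsym y j (r.+1 - i.+1)
    + y j * ((\sum_(l < j) y l ^+ i.+1) * hsym y j.+1 (r - i.+1)))); last first.
  move=> i _; rewrite subSS; have -> : (r - i = (r - i.+1).+1)%N by have := ltn_ord i; lia.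
  by rewrite hsymS; ring.
have := IHj r.+1; rewrite big_ord_recr /= subSS => IHj'.
have IHr' : r%:R * hsym y j.+1 r =
  \sum_(i < r) (\sum_(l < j) y l ^+ i.+1) * hsym y j.+1 (r - i.+1)
  + \sum_(i < r) y j ^+ i.+1 * hsym y j.+1 (r - i.+1).
  by rewrite IHr -big_split; apply: eq_bigr => i _; rewrite big_ord_recr /= mulrDl.
rewrite big_split /= -mulr_sumr subnn !hsym_deg0 subn0.
have -> : \sum_(i < r) y j ^+ (bump 0 i).+1 * hsym y j.+1 (r - bump 0 i) =
    y j * \sum_(i < r) y j ^+ i.+1 * hsym y j.+1 (r - i.+1).
  rewrite mulr_sumr; apply: eq_bigr => i _.
  by rewrite /bump /= add1n exprS mulrA.
move: IHj'; rewrite subnn hsym_deg0 => IHj'.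
rewrite hsymS -[r.+1%:R]natr1 in IHj' *.
have -> : (r%:R + 1) * (hsym y j r.+1 + y j * hsym y j.+1 r) =
  (r%:R + 1) * hsym y j r.+1 + y j * (r%:R * hsym y j.+1 r) + y j * hsym y j.+1 r.
  by ring.
rewrite IHj' IHr'; ring.
Qed.

End CompleteSymmetric.

Lemma rmorph_hsym (R R' : comNzRingType) (f : {rmorphism R -> R'}) y j r :
  f (hsym y j r) = hsym (fun i => f (y i)) j r.
Proof.
elim: j r => [|j IHj] r; first by rewrite [LHS]rmorph_nat.
by rewrite -!hstep_hsym /hstep rmorph_sum; apply: eq_bigr => i _; rewrite rmorphM rmorphXn IHj.
Qed.

Lemma hsym_polyC (R : comNzRingType) (y : nat -> R) j r :
  hsym (fun i => (y i)%:P) j r = (hsym y j r)%:P.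
Proof. by rewrite (rmorph_hsym (polyC : {rmorphism R -> {poly R}})). Qed.

(** * The tower of monic generators *)

Section Tower.
Variables (C : numClosedFieldType) (a m k : nat).
Hypothesis a_gt0 : (0 < a)%N.

Definition ypow n i : mpoly C n := mvar C n i ^+ a.

Lemma ypow_lt n i : (i < n)%N ->
  ypow n.+1 i = ((ypow n i)%:P : {poly mpoly C n}).
Proof. by move=> lt_in; rewrite /ypow mvar_lt // -polyC_exp. Qed.

Lemma hsym_ypow_lt n j r : (j <= n)%N ->
  hsym (ypow n.+1) j r = ((hsym (ypow n) j r)%:P : {poly mpoly C n}).
Proof.
move=> le_jn.
rewrite -hsym_polyC; apply: eq_hsym => i lt_ij; by rewrite ypow_lt // (leq_trans lt_ij).
Qed.

(** With [j = d + k] and [n = m + k] this is [h_(n - j) (y_0, ..., y_j)], viewed as a polynomial in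
    its last variable [x_j]. *)
Definition tgen d : {poly mpoly C (d + k)} :=
  hsym (ypow (d + k).+1) (d + k).+1 (m - d).

Lemma tgenE d : tgen d =
  \sum_(i < (m - d).+1) (hsym (ypow (d + k)) (d + k) (m - d - i)) *: 'X^(a * i).
Proof.
rewrite /tgen -hstep_hsym; apply: eq_bigr => i _.
by rewrite hsym_ypow_lt // /ypow mvar_last -mul_polyC mulrC exprM.
Qed.

Lemma size_tgen_monic d :
  tgen d \is monic /\ size (tgen d) = (a * (m - d)).+1.
Proof.
rewrite tgenE big_ord_recr /= subnn hsym_deg0 scale1r addrC.
set s := \sum_(i < _) _.
have lt_s : (size s < size ('X^(a * (m - d)) : {poly mpoly C (d + k)}))%N.
  rewrite size_polyXn ltnS; apply: leq_trans (size_sum _ _ _) _.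
  apply/bigmax_leqP => i _; apply: leq_trans (size_scale_leq _ _) _.
  by rewrite size_polyXn ltn_mul2l a_gt0 ltn_ord.
split; last by rewrite size_polyDl // size_polyXn.
by rewrite monicE lead_coefDl // lead_coefXn.
Qed.

Lemma tgen_monic d : tgen d \is monic.
Proof. by case: (size_tgen_monic d). Qed.

Lemma size_tgen d : size (tgen d) = (a * (m - d)).+1.
Proof. by case: (size_tgen_monic d). Qed.

(* The ideal generated by [Q] and [tgen 0, ..., tgen (d - 1)]. *)
Fixpoint tower (Q : mpoly C k -> Prop) d : mpoly C (d + k) -> Prop :=
  match d return mpoly C (d + k) -> Prop with
  | 0 => Q
  | d'.+1 => fun f => exists q r : {poly mpoly C (d' + k)},
      (f : {poly _}) = q * tgen d' + r /\ forall i, tower Q r`_i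
  end.

Section Base.
Variables (Q : mpoly C k -> Prop).
Hypothesis idQ : ideal Q.

Lemma ideal_tower d : ideal (tower Q (d := d)).
Proof.
elim: d => //= d IHd; have idr := ideal_map_poly IHd; split.
- by exists 0, 0; split=> [|i]; rewrite ?mul0r ?add0r ?coef0 //; apply: ideal_zero.
- move=> x y [q1 [r1 [-> T1]]] [q2 [r2 [-> T2]]].
  exists (q1 + q2), (r1 + r2); split; first by rewrite mulrDl addrACA.
  exact: (ideal_add idr).
- move=> x y [q [r [-> Tr]]]; exists (x * q), (x * r).
  by split; [rewrite mulrDr mulrA | apply: (ideal_mul idr)].
Qed.

Lemma tower_polyC d (c : mpoly C (d + k)) :
  tower Q c -> tower Q (d := d.+1) (c%:P : {poly _}).
Proof.
move=> Tc; exists 0, c%:P; split=> [|i]; first by rewrite mul0r add0r.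
by rewrite coefC; case: ifP => // _; apply: ideal_zero (ideal_tower d).
Qed.

Lemma tower_tgen d : tower Q (d := d.+1) (tgen d).
Proof.
exists 1, 0; split=> [|i]; first by rewrite mul1r addr0.
by rewrite coef0; apply: ideal_zero (ideal_tower d).
Qed.

(** The coefficients of a reduced remainder are determined modulo the tower below; along [d] this is
    the freeness of the quotient over the base. *)
Lemma tower_remainder d (q r : {poly mpoly C (d + k)}) :
    tower Q (d := d.+1) (q * tgen d + r) -> (size r < size (tgen d))%N ->
  forall i, tower Q r`_i.
Proof.
move=> [q1 [r1 [eqf Tr1]]] lt_r.
exact: (remainder_coef_ideal (ideal_tower d) (tgen_monic d) (esym eqf) lt_r).
Qed.

(** The recursion [hsymS] climbs from the generator [tgen d], of degree [m - d] in the [y_i], up to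
    degree [m]; its terms with one variable fewer lie in the tower below. At the top every degree
    from 1 to [m] is reached. *)
Lemma tower_hsym d r :
  (d <= m)%N -> (m - d < r <= m)%N -> tower Q (hsym (ypow (d + k)) (d + k) r).
Proof.
elim: d r => [|d IHd] r le_dm; first by rewrite subn0; case: ltngtP.
elim: r => [|r IHr] /andP[lt_r le_r]; first by rewrite ltn0 in lt_r.
have [eq_r|ne_r] := eqVneq r.+1 (m - d)%N.
  by rewrite eq_r; apply: tower_tgen.
change (tower Q (d := d.+1) (hsym (ypow (d + k).+1) (d + k).+1 r.+1)).
rewrite hsymS; apply: (ideal_add (ideal_tower d.+1)).
  rewrite hsym_ypow_lt //; apply: tower_polyC; apply: IHd; lia.
by apply: (ideal_mul (ideal_tower d.+1)); apply: IHr; lia.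
Qed.

Lemma tower_psum i : (0 < i <= m)%N -> tower Q (d := m) (psum C (m + k) (i * a)).
Proof.
elim/ltn_ind: i => -[//|i] IHi lt_im.
have Th r : (0 < r <= m)%N -> tower Q (d := m) (hsym (ypow (m + k)) (m + k) r).
  by move=> lt_r; apply: tower_hsym; rewrite ?subnn.
have idT := ideal_tower m.
have psumE j : \sum_(l < m + k) ypow (m + k) l ^+ j = psum C (m + k) (j * a).
  by apply: eq_bigr => l _; rewrite /ypow -exprM mulnC.
have := hsym_newton (ypow (m + k)) (m + k) i.+1.
rewrite big_ord_recr /= subnn hsym_deg0 mulr1 psumE => /(congr1 (fun u =>
  u - \sum_(j < i) (\sum_(l < m + k) ypow (m + k) l ^+ j.+1) *
        hsym (ypow (m + k)) (m + k) (i.+1 - j.+1))).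
rewrite [_ + psum _ _ _]addrC addrK => <-.
apply: (ideal_sub idT); first by apply: (ideal_mul idT); apply: Th.
apply: (ideal_sum idT) => j _; rewrite psumE; apply: (ideal_mulr idT).
by have := ltn_ord j; move=> ?; apply: IHi; lia.
Qed.

(* Evaluation at the [x_i] embeds the partial polynomial rings into the full one. *)
Definition embed j : {rmorphism mpoly C j -> mpoly C (m + k)} :=
  mev (mcst C (m + k)) (mvar C (m + k)) j.

Lemma embed_id : embed (m + k) =1 id.
Proof.
apply: (@mpoly_morph_ext _ _ _ (embed (m + k)) idfun) => [c|i lt_i] /=.
  exact: mev_cst.
exact: mev_var.
Qed.

(** With [tower_psum], this identifies the top tower with the ideal generated by [Q] and the power
    sums. In characteristic 0 Newton's identities can be solved for the [h_r], and [hsymS] then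
    removes variables one at a time until the generators appear. *)
Lemma tower_sub (P : mpoly C (m + k) -> Prop) :
    ideal P -> (forall i, (0 < i <= m)%N -> P (psum C (m + k) (i * a))) ->
    (forall q, Q q -> P (embed k q)) ->
  forall f, tower Q (d := m) f -> P f.
Proof.
move=> idP Pp PQ.
pose h := hsym (ypow (m + k)).
have Ph r : (0 < r <= m)%N -> P (h (m + k)%N r).
  move=> /andP[r_gt0 le_rm].
  have := hsym_newton (ypow (m + k)) (m + k) r.
  move=> /(congr1 (fun u => mcst C (m + k) r%:R^-1 * u)).
  rewrite mulrA -(rmorph_nat (mcst C (m + k))) -rmorphM mulVf ?pnatr_eq0; last by lia.
  rewrite rmorph1 mul1r -/h => ->; apply: (ideal_mul idP).
  apply: (ideal_sum idP) => i _; apply: (ideal_mulr idP).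
  rewrite (_ : \sum_(l < _) _ = psum C (m + k) (i.+1 * a)).
    by have := ltn_ord i; move=> ?; apply: Pp; lia.
  by apply: eq_bigr => l _; rewrite /ypow -exprM mulnC.
have Ph' i r : (i <= m)%N -> (i < r <= m)%N -> P (h (m + k - i)%N r).
  elim: i r => [|i IHi] r le_im lt_ir; first by rewrite subn0; apply: Ph.
  have -> : h (m + k - i.+1)%N r =
     h (m + k - i)%N r - ypow (m + k) (m + k - i.+1) * h (m + k - i)%N r.-1.
    have -> : (m + k - i = (m + k - i.+1).+1)%N by lia.
    by rewrite /h; case: r lt_ir => [|r] lt_ir; [lia | rewrite hsymS addrK].
  by apply: (ideal_sub idP); [|apply: (ideal_mul idP)]; apply: IHi; lia.
have Pd d : (d <= m)%N -> forall f, tower Q f -> P (embed (d + k) f).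
  elim: d => [|d IHd] lt_dm f; first exact: PQ.
  move=> [q [r [-> Tr]]]; rewrite rmorphD rmorphM; apply: (ideal_add idP).
    apply: (ideal_mul idP); rewrite /tgen (rmorph_hsym (embed (d + k).+1)).
    rewrite (@eq_hsym _ _ (ypow (m + k))); last first.
      by move=> i lt_i; rewrite /ypow rmorphXn /embed mev_var.
    have ed : ((d + k).+1 = m + k - (m - d.+1))%N by lia.
    by rewrite ed; apply: Ph'; lia.
  rewrite /embed mevS horner_coef; apply: (ideal_sum idP) => i _.
  rewrite coef_map; apply: (ideal_mulr idP); apply: (IHd (ltnW lt_dm)); exact: Tr.
by move=> f Tf; rewrite -(embed_id f); apply: Pd.
Qed.

End Base.

End Tower.

(** * Points of the tower over a base point *)

Lemma separable_root_avoid (C : numClosedFieldType) (g r : {poly C}) :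
    separable_poly g -> r != 0 -> (size r < size g)%N ->
  exists z, root g z /\ ~~ root r z.
Proof.
move=> sep_g r0 lt_rg; have [rs g_rs] := closed_field_poly_normal g.
have g0 : g != 0 by rewrite -size_poly_gt0; apply: leq_trans lt_rg.
have lc0 : lead_coef g != 0 by rewrite lead_coef_eq0.
have uniq_rs : uniq rs.
  rewrite -separable_prod_XsubC.
  by apply: dvdp_separable sep_g; rewrite [X in _ %| X]g_rs dvdpZr.
(* [g] has [size g - 1] distinct roots, more than the nonzero [r] can have. *)
have [/(max_poly_roots r0)/(_ uniq_rs)|/allPn[z z_rs rz]] := boolP (all (root r) rs).
  move: lt_rg; rewrite g_rs size_scale // size_prod_XsubC ltnS => le1 lt2.
  by rewrite leqNgt lt2 in le1.
by exists z; rewrite g_rs rootZ // root_prod_XsubC.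
Qed.

Section TowerPoints.
Variables (C : numClosedFieldType) (a m k : nat).
Hypothesis a_gt0 : (0 < a)%N.
Implicit Type w : nat -> C.

Notation ev w n := (mev (idfun : {rmorphism C -> C}) w n).
Notation gen := (tgen C a m k).

Definition wpow w i : C := w i ^+ a.

Definition on_tower w d :=
  forall e, (e < d)%N -> hsym (wpow w) (e + k).+1 (m - e) = 0.

Lemma ev_hsym w n j r : (j <= n)%N ->
  ev w n (hsym (@ypow C a n) j r) = hsym (wpow w) j r.
Proof.
move=> le_jn; rewrite (rmorph_hsym (ev w n)); apply: eq_hsym => i lt_ij.
by rewrite /ypow rmorphXn mev_var // (leq_trans lt_ij).
Qed.

Lemma map_tgen w d : map_poly (ev w (d + k)) (gen d) =
  hstep (fun i => (wpow w i)%:P) (d + k) (m - d) 'X^a.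
Proof.
rewrite (tgenE C a m k) rmorph_sum; apply: eq_bigr => i _.
rewrite -mul_polyC rmorphM /= map_polyC map_polyXn exprM mulrC; congr (_ * _).
by rewrite hsym_polyC -(ev_hsym w _ (leqnn _)).
Qed.

(** [Y = 'X] gives the polynomial whose roots are the [y_i] on the fibre over [w], and [Y = 'X^a]
    the specialisation of [tgen 0]. *)
Definition fibre_poly w (Y : {poly C}) := hstep (fun i => (wpow w i)%:P) k m Y.

(** Each equation of the tower kills the constant term in the divided difference [hstep_factor], so
    one more factor splits off. *)
Lemma fibre_poly_split w d Y : (d <= m)%N -> on_tower w d ->
  fibre_poly w Y = (\prod_(i < d) (Y - (wpow w (i + k))%:P))
                   * hstep (fun i => (wpow w i)%:P) (d + k) (m - d) Y.
Proof.
elim: d => [|d IHd] lt_dm Vw; first by rewrite big_ord0 mul1r subn0.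
rewrite IHd ?(ltnW lt_dm) // => [|e lt_ed]; last by apply: Vw; apply: ltnW.
rewrite big_ord_recr -mulrA; congr (_ * _).
have := Vw d (ltnSn d).
have -> : (m - d = (m - d.+1).+1)%N by lia.
move=> hVd; rewrite hstep_factor.
by rewrite hsym_polyC hVd add0r.
Qed.

Lemma eq_fibre_poly w1 w2 Y :
  (forall i, (i < k)%N -> w1 i = w2 i) -> fibre_poly w1 Y = fibre_poly w2 Y.
Proof.
by move=> eq_w; apply: eq_hstep => i lt_ik; rewrite /wpow eq_w.
Qed.

Lemma tower_vanish (Q : mpoly C k -> Prop) w d (f : mpoly C (d + k)) :
    (forall q, Q q -> ev w k q = 0) -> on_tower w d ->
  tower a m Q f -> ev w (d + k) f = 0.
Proof.
move=> Q0; elim: d f => [|d IHd] f Vw; first exact: Q0.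
move=> [q [r [-> Tr]]].
change (ev w (d + k).+1 (q * gen d + r : {poly _}) = 0).
rewrite rmorphD rmorphM /tgen ev_hsym // (Vw d) // mulr0 add0r.
rewrite mevS horner_coef big1 // => i _.
rewrite coef_map [X in X * _](_ : _ = 0) ?mul0r //.
by apply: (IHd _ _ (Tr i)) => e lt_ed; apply: Vw; apply: ltnW.
Qed.

Definition upd w j z : nat -> C := fun i => if i == j then z else w i.

Lemma ev_upd w j z n (f : mpoly C n) : (n <= j)%N -> ev (upd w j z) n f = ev w n f.
Proof.
by move=> le_nj; apply: eq_mev => i lt_in; rewrite /upd ltn_eqF // (leq_trans lt_in).
Qed.

Lemma ev_updS w z n (f : mpoly C n.+1) :
  ev (upd w n z) n.+1 f = (map_poly (ev w n) f).[z].
Proof.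
rewrite mevS /upd eqxx; congr _.[z]; apply/polyP => i.
by rewrite !coef_map; apply: ev_upd.
Qed.

Lemma on_tower_upd w d z : on_tower w d ->
    root (hstep (fun i => (wpow w i)%:P) (d + k) (m - d) 'X^a) z ->
  on_tower (upd w (d + k) z) d.+1.
Proof.
move=> Vw /rootP z_root e; rewrite ltnS leq_eqVlt => /predU1P[->|lt_ed].
  rewrite -(ev_hsym _ _ (leqnn _)) -z_root -map_tgen.
  exact: (ev_updS w z (gen d)).
rewrite -(Vw e lt_ed); apply: eq_hsym => l lt_l.
by rewrite /wpow /upd ltn_eqF //; lia.
Qed.

(** Some coefficient of the remainder of [f] lies outside the tower below, hence is nonzero at a
    point by induction. The specialised remainder is then nonzero, of smaller degree than the
    separable [g1], and a root of [g1] that it avoids extends the point. *)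
Lemma tower_interpolation (Q : mpoly C k -> Prop) d (f : mpoly C (d + k)) :
    ideal Q -> (d <= m)%N -> ~ tower a m Q f ->
  exists D, ~ Q D /\ forall w, ev w k D != 0 -> separable_poly (fibre_poly w 'X^a) ->
    exists w', [/\ forall i, (i < k)%N -> w' i = w i, on_tower w' d
                 & ev w' (d + k) f != 0].
Proof.
move=> idQ; elim: d f => [|d IHd] f lt_dm Tf.
  by exists f; split=> // w fw _; exists w.
have [q [r [def_f lt_r]]] := monic_division (tgen_monic C m k a_gt0 d) f.
have [i Tri] : exists i, ~ tower a m Q (d := d) r`_i.
  by apply: not_all_ex_not => Tr; apply: Tf; exists q, r.
have [D [QD DP]] := IHd _ (ltnW lt_dm) Tri.
exists D; split=> // w wD sep_w; have [w1 [eq_w1 Vw1 w1r]] := DP w wD sep_w.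
pose g1 := map_poly (ev w1 (d + k)) (gen d).
pose r1 := map_poly (ev w1 (d + k)) r.
have [z [gz rz]] : exists z, root g1 z /\ ~~ root r1 z.
  apply: separable_root_avoid.
  (* On the tower, [g1] is a factor of the fibre polynomial. *)
  - apply: dvdp_separable sep_w; rewrite -(eq_fibre_poly _ eq_w1).
    by rewrite (fibre_poly_split _ (ltnW lt_dm) Vw1) -map_tgen dvdp_mull.
  - by apply: contraNneq w1r => /(congr1 (coefp i)); rewrite /= coef_map coef0 => ->.
  - rewrite [size g1]size_map_poly_id0; last first.
      by rewrite (monicP (tgen_monic C m k a_gt0 d)) rmorph1 oner_eq0.
    by apply: leq_ltn_trans lt_r; apply: size_poly.
exists (upd w1 (d + k) z); split.
- by move=> j lt_jk; rewrite -eq_w1 // /upd ltn_eqF //; lia.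
- by apply: on_tower_upd; rewrite // -map_tgen.
change (ev (upd w1 (d + k) z) (d + k).+1 f != 0); rewrite ev_updS def_f.
by rewrite rmorphD rmorphM hornerD hornerM (rootP gz) mulr0 add0r.
Qed.

Lemma on_tower_exists w d : (d <= m)%N ->
  exists w', (forall i, (i < k)%N -> w' i = w i) /\ on_tower w' d.
Proof.
elim: d => [|d IHd] lt_dm; first by exists w.
have [w1 [eq_w1 Vw1]] := IHd (ltnW lt_dm).
have [z gz] : exists z, root (map_poly (ev w1 (d + k)) (gen d)) z.
  apply/closed_rootP; rewrite size_map_poly_id0; last first.
    by rewrite (monicP (tgen_monic C m k a_gt0 d)) rmorph1 oner_eq0.
  by rewrite size_tgen // eqSS muln_eq0; lia.
exists (upd w1 (d + k) z); split.
  by move=> j lt_jk; rewrite -eq_w1 // /upd ltn_eqF //; lia.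
by apply: on_tower_upd; rewrite // -map_tgen.
Qed.

(** This follows the recursion of [tower], which allows induction; [embed_up] identifies it with the
    evaluation [embed]. *)
Fixpoint up d : {rmorphism mpoly C k -> mpoly C (d + k)} :=
  match d return {rmorphism mpoly C k -> mpoly C (d + k)} with
  | 0 => idfun
  | e.+1 => (polyC : mpoly C (e + k) -> {poly mpoly C (e + k)}) \o up e
  end.

Lemma embed_up : embed C m k k =1 up m.
Proof.
apply: mpoly_morph_ext => [c|i lt_ik].
  rewrite [LHS]mev_cst; elim: m => // d IHd.
  by rewrite -[mcst _ _ _]/((mcst C (d + k) c)%:P) IHd.
rewrite [LHS]mev_var //; elim: m => // d IHd.
rewrite -[(d.+1 + k)%N]/(d + k).+1 mvar_lt ?IHd //.
by apply: leq_trans lt_ik (leq_addl _ _).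
Qed.

Lemma tower_up (Q : mpoly C k -> Prop) d c : ideal Q ->
  Q c -> tower a m Q (up d c).
Proof. by move=> idQ Qc; elim: d => // d IHd; apply: tower_polyC. Qed.

(** Multiplication by an element of the base acts on the coefficients of remainders, so regularity
    modulo [Q] passes up the tower. *)
Lemma tower_regular (Q : mpoly C k -> Prop) c d (f : mpoly C (d + k)) :
    ideal Q -> (forall x, Q (c * x) -> Q x) ->
  tower a m Q (up d c * f) -> tower a m Q f.
Proof.
move=> idQ regc; elim: d f => [|d IHd] f; first exact: regc.
have [q [r [-> lt_r]]] := monic_division (tgen_monic C m k a_gt0 d) f.
rewrite -[up _ _]/((up d c)%:P) => Tcf; exists q, r; split=> // i; apply: IHd.
rewrite -coefCM; apply: (tower_remainder a_gt0 idQ (q := (up d c)%:P * q)).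
  by rewrite -mulrA -mulrDr.
apply: leq_ltn_trans lt_r; rewrite mul_polyC; exact: size_scale_leq.
Qed.

(** The division by [tgen d] is the same for every [Qs j], so the question passes to the
    coefficients of a single remainder. *)
Lemma tower_separated (Qs : nat -> mpoly C k -> Prop) (Q : mpoly C k -> Prop)
    d (f : mpoly C (d + k)) :
    (forall j, ideal (Qs j)) -> (forall x, (forall j, Qs j x) -> Q x) ->
  (forall j, tower a m (Qs j) f) -> tower a m Q f.
Proof.
move=> idQs sepQ; elim: d f => [|d IHd] f; first exact: sepQ.
have [q [r [-> lt_r]]] := monic_division (tgen_monic C m k a_gt0 d) f.
move=> Tf; exists q, r; split=> // i; apply: IHd => j.
exact: (tower_remainder a_gt0 (idQs j) (Tf j)).
Qed.

End TowerPoints.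

(** * The branch locus and reduced fibres *)

(* Test the vanishing power sums against [X * prod (X - v)], where [v] runs
   over the distinct values other than 0 and 1: otherwise its degree is at most
   [size ys], and it takes a nonzero value at 1 only. *)
Lemma vanishing_psum_uniq (F : numFieldType) (c : nat) (ys : seq F) : (0 < c)%N ->
    (forall r, (0 < r <= size ys)%N -> c%:R + \sum_(y <- ys) y ^+ r = 0) ->
  uniq ys && (0 \notin ys).
Proof.
move=> c_gt0 ps0; apply/negPn/negP => bad.
pose s := undup [seq y <- ys | (y != 0) && (y != 1)].
have lt_s : (size s < size ys)%N.
  have sub_s : {subset s <= undup ys}.
    by move=> y; rewrite !mem_undup mem_filter => /andP[].
  have le_s := uniq_leq_size (undup_uniq _) sub_s.
  have le_ys := size_undup ys.
  rewrite negb_and negbK in bad; case/orP: bad => [|ys0].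
    by rewrite -ltn_size_undup; apply: leq_ltn_trans.
  apply: leq_trans le_ys; apply: (@uniq_leq_size _ (0 :: s)).
    by rewrite /= undup_uniq mem_undup mem_filter eqxx.
  by move=> y /predU1P[->|/sub_s//]; rewrite mem_undup.
pose q : {poly F} := 'X * \prod_(v <- s) ('X - v%:P).
have q1 : q.[1] != 0.
  rewrite hornerM hornerX mul1r -/(root _ 1) root_prod_XsubC.
  by rewrite mem_undup mem_filter eqxx andbF.
have qE y : y \in ys -> q.[y] = (y == 1)%:R * q.[1].
  move=> ys_y; have [->|y1] := eqVneq y 1; first by rewrite mul1r.
  rewrite mul0r hornerM hornerX; have [->|y0] := eqVneq y 0; first by rewrite mul0r.
  apply/eqP; rewrite mulf_eq0 -/(root _ y) root_prod_XsubC.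
  by rewrite mem_undup mem_filter y0 y1 ys_y orbT.
have q0 : q`_0 = 0 by rewrite coefXM.
have size_q : (size q <= (size ys).+1)%N.
  rewrite (leq_trans (size_polyMleq _ _)) //.
  by rewrite size_polyX size_prod_XsubC.
have : c%:R * q.[1] + \sum_(y <- ys) q.[y] = 0.
  rewrite horner_coef mulr_sumr (eq_bigr (fun y => \sum_(i < size q) q`_i * y ^+ i));
    last by move=> y _; rewrite horner_coef.
  rewrite exchange_big -big_split big1 //= => i _.
  rewrite expr1n mulr1 mulrC -mulr_sumr -mulrDr.
  have [->|i_gt0] := posnP i; first by rewrite q0 mul0r.
  rewrite ps0 ?mulr0 // i_gt0 /=.
  by have := leq_trans (ltn_ord i) size_q; rewrite ltnS.
(* The sum is [q.[1]] times [c] plus the multiplicity of 1 in [ys], a positive integer. *)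
rewrite big_seq (eq_bigr (fun y => (y == 1)%:R * q.[1])) -?big_seq; last exact: qE.
rewrite -mulr_suml -mulrDl => /eqP; rewrite mulf_eq0 (negPf q1) orbF.
rewrite -natr_sum -natrD pnatr_eq0; lia.
Qed.

(** The chain rule factors the derivative as [a X^(a-1) p'(X^a)]. The powers of [X] are harmless
    because [p(0)] is nonzero, and coprimality of [p] and [p'] survives composition. *)
Lemma separable_comp_polyXn (F : numFieldType) (a : nat) (p : {poly F}) :
    (0 < a)%N -> separable_poly p -> ~~ root p 0 ->
  coprimep (p \Po 'X^a) ('X * (p \Po 'X^a)^`()).
Proof.
move=> a_gt0 sep_p p0.
have cop_X : coprimep (p \Po 'X^a) 'X.
  by rewrite coprimepX /root horner_comp hornerXn expr0n eqn0Ngt a_gt0.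
rewrite coprimepMr cop_X deriv_comp coprimepMr coprimep_comp_poly //=.
rewrite derivXn -scaler_nat coprimepZr ?pnatr_eq0 -?lt0n //.
  exact: coprimep_expr.
by rewrite unlock in sep_p.
Qed.

Section BranchLocus.
Variables (C : numClosedFieldType) (a m k' : nat).
Hypotheses (a_gt0 : (0 < a)%N) (m_gt0 : (0 < m)%N).
Implicit Type w : nat -> C.
Notation k := k'.+2.
Notation ev w n := (mev (idfun : {rmorphism C -> C}) w n).

Lemma psum_on_tower w r : on_tower a m k w m -> (0 < r <= m)%N ->
  \sum_(l < m + k) wpow a w l ^+ r = 0.
Proof.
move=> Vw lt_r.
have psum0 : ev w (m + k) (psum C (m + k) (r * a)) = 0.
  apply: (tower_vanish (Q := fun x => x = 0) _ Vw) => [q ->|]; first exact: rmorph0.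
  exact: (tower_psum a_gt0 (ideal_eq0 _) lt_r).
rewrite -[RHS]psum0 rmorph_sum.
by apply: eq_bigr => l _; rewrite rmorphXn mev_var // /wpow -exprM mulnC.
Qed.

Definition fibre_values w := map (wpow a w) (iota k m).

Lemma fibre_polyE w Y : on_tower a m k w m ->
  fibre_poly a m k w Y = \prod_(y <- fibre_values w) (Y - y%:P).
Proof.
move=> Vw; rewrite (fibre_poly_split a_gt0 Y (leqnn m) Vw) subnn hstep_deg0 mulr1 /fibre_values.
have -> : iota k m = index_iota k (m + k) by rewrite /index_iota addnK.
by rewrite big_map -{2}[k%N]add0n big_addn addnK big_mkord.
Qed.

(* Over the base point (0, ..., 0, 1, c) a repetition among the remaining
   [x_i ^ a] would be incompatible with the vanishing of the power sums. *)
Definition base_point (c : bool) i : C :=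
  if i == k' then 1 else if i == k'.+1 then c%:R else 0.

Lemma base_point_separable c :
  coprimep (fibre_poly a m k (base_point c) 'X^a)
           ('X * (fibre_poly a m k (base_point c) 'X^a)^`()).
Proof.
have [w [eq_w Vw]] := on_tower_exists k a_gt0 (base_point c) (leqnn m).
have /andP[uniq_ys ys0] : uniq (fibre_values w) && (0 \notin fibre_values w).
  (* The coordinates 1 and [c] of the base point contribute [c.+1] to every power sum. *)
  apply: (@vanishing_psum_uniq _ c.+1) => // r.
  rewrite size_map size_iota => lt_r.
  have ar0 : (a * r == 0)%N = false by rewrite muln_eq0; lia.
  rewrite -[RHS](psum_on_tower Vw lt_r).
  rewrite -(big_mkord xpredT (fun l => wpow a w l ^+ r)) addnC.
  rewrite (@big_cat_nat _ _ _ k) ?leq_addr //=; congr (_ + _).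
    rewrite big_mkord !big_ord_recr big1 /= => [|i _]; last first.
      have lt_ik := ltn_ord i; rewrite /wpow eq_w /base_point; last by lia.
      by rewrite !ltn_eqF ?ltnS ?(ltnW lt_ik) // -exprM expr0n ar0.
    rewrite /wpow !eq_w // /base_point eqxx eqn_leq ltnn eqxx add0r.
    rewrite -!exprM expr1n -natr1 addrC; congr (_ + _).
    by case: c {eq_w}; rewrite ?expr1n // expr0n ar0.
  by rewrite big_map /index_iota addKn.
rewrite -(eq_fibre_poly a m 'X^a eq_w) fibre_polyE //.
have -> : \prod_(y <- fibre_values w) ('X^a - y%:P) =
    (\prod_(y <- fibre_values w) ('X - y%:P)) \Po 'X^a.
  rewrite rmorph_prod; apply: eq_bigr => y _.
  by rewrite rmorphB /= comp_polyX comp_polyC.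
apply: separable_comp_polyXn; rewrite ?separable_prod_XsubC //.
by rewrite root_prod_XsubC.
Qed.

(* Multiplying the derivative by [X] keeps both sizes above 1, also when
   [a = m = 1]. *)
Definition branch : mpoly C k :=
  resultant (tgen C a m k 0) ('X * (tgen C a m k 0)^`()).

Lemma map_tgen0 w : map_poly (ev w k) (tgen C a m k 0) = fibre_poly a m k w 'X^a.
Proof. by rewrite (map_tgen a m k w 0) subn0. Qed.

Let g := tgen C a m k 0.

Lemma size_tgen0 : size g = (a * m).+1.
Proof. by rewrite size_tgen // subn0. Qed.

Let am_gt0 : (0 < a * m)%N. Proof. by rewrite muln_gt0 a_gt0. Qed.

Lemma coef_tgen_derivX : ('X * g^`())`_(a * m) = (a * m)%:R.
Proof.
rewrite coefXM eqn0Ngt am_gt0 coef_deriv prednK //.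
by have := monicP (tgen_monic C m k a_gt0 0); rewrite lead_coefE size_tgen0 => ->.
Qed.

Lemma size_tgen_derivX : size ('X * g^`()) = (a * m).+1.
Proof.
apply/anti_leq/andP; split.
  apply: leq_trans (size_polyMleq _ _) _; rewrite size_polyX /= -size_tgen0.
  exact: lt_size_deriv (monic_neq0 (tgen_monic C m k a_gt0 0)).
rewrite ltnNge; apply/negP => /leq_sizeP/(_ _ (leqnn _)) /eqP.
rewrite coef_tgen_derivX => /eqP/(congr1 (ev (fun=> 0) k)).
by move/eqP; rewrite rmorph_nat rmorph0 pnatr_eq0 eqn0Ngt am_gt0.
Qed.

Lemma map_tgen_derivX w :
  map_poly (ev w k) ('X * g^`()) = 'X * (fibre_poly a m k w 'X^a)^`().
Proof. by rewrite rmorphM /= map_polyX -deriv_map map_tgen0. Qed.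

(** The resultant is a combination of its two arguments; specialised at [w], this is a Bezout
    relation with a nonzero constant. *)
Lemma branch_separable w :
  ev w k branch != 0 -> separable_poly (fibre_poly a m k w 'X^a).
Proof.
move=> bw.
have [||[u v] _ /=] := @resultant_in_ideal _ g ('X * g^`()).
- by rewrite size_tgen0 ltnS.
- by rewrite size_tgen_derivX ltnS.
move=> /(congr1 (map_poly (ev w k))).
rewrite rmorphD !rmorphM /= map_polyC map_polyX -deriv_map map_tgen0 => eqB.
rewrite unlock; apply/Bezout_coprimepP.
exists (map_poly (ev w k) u, map_poly (ev w k) v * 'X) => /=.
rewrite -mulrA -eqB polyC_eqp1; exact: bw.
Qed.

(** Both leading coefficients survive specialisation, so the resultant commutes with it. As
    [base_point c] satisfies [x_(k-1) = c x_(k-2)], [branch] does not vanish identically on that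
    hyperplane. *)
Lemma branch_base_point c : ev (base_point c) k branch != 0.
Proof.
set w := base_point c.
have lc1 : ev w k (lead_coef g) != 0.
  by rewrite (monicP (tgen_monic C m k a_gt0 0)) rmorph1 oner_eq0.
have lc2 : ev w k (lead_coef ('X * g^`())) != 0.
  by rewrite lead_coefE size_tgen_derivX coef_tgen_derivX rmorph_nat pnatr_eq0 -lt0n.
have -> : ev w k branch =
    resultant (fibre_poly a m k w 'X^a) ('X * (fibre_poly a m k w 'X^a)^`()).
  rewrite -map_tgen_derivX -map_tgen0.
  exact: (@map_resultant (mpoly C k'.+1) C (ev w k) g ('X * g^`()) lc1 lc2).
rewrite resultant_eq0 -leqNgt; move: (base_point_separable c).
by rewrite coprimep_def => /eqP->.
Qed.

End BranchLocus.

(** * Linear forms of reflections on the base *)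

Section RootForm.
Variables (C : numClosedFieldType) (k' : nat) (c : bool).
Implicit Type w : nat -> C.
Notation k := k'.+2.
Notation ev w n := (mev (idfun : {rmorphism C -> C}) w n).

(* For [c = true] the reflecting hyperplane of the transposition of the last
   two base variables, for [c = false] that of the scalings of the last one. *)
Definition root_form : mpoly C k :=
  ('X : {poly mpoly C k'.+1}) - (c%:R * mvar C k'.+1 k')%:P.

Definition form_ideal j (f : mpoly C k) := exists s, f = root_form ^+ j * s.

Lemma ideal_form j : ideal (form_ideal j).
Proof.
split=> [|x y [s ->] [t ->]|x y [s ->]]; first by exists 0; rewrite mulr0.
  by exists (s + t); rewrite mulrDr.
by exists (x * s); rewrite mulrCA.
Qed.

Lemma root_formE : root_form = mvar C k k'.+1 - c%:R * mvar C k k'.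
Proof.
rewrite mvar_last mvar_lt // /root_form; congr (_ - _).
by case: c; rewrite ?mul1r ?mul0r.
Qed.

Lemma ev_root_form w : ev w k root_form = w k'.+1 - c%:R * w k'.
Proof. by rewrite root_formE rmorphB rmorphM !mev_var // rmorph_nat. Qed.

Lemma root_form_neq0 : root_form <> 0.
Proof. by apply/eqP; exact: monic_neq0 (monicXsubC (c%:R * mvar C k'.+1 k')). Qed.

Lemma root_form_regular (x : mpoly C k) : root_form * x = 0 -> x = 0.
Proof.
move=> lx; apply: NNPP => x0.
exact: (mpoly_mul_neq0 root_form_neq0 x0) lx.
Qed.

(** The form is monic in the last variable, so a nonzero multiple of its [j]-th power has degree at
    least [j] there; [j = size f] is too large. *)
Lemma form_ideal_separated (f : mpoly C k) : (forall j, form_ideal j f) -> f = 0.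
Proof.
move=> Lf; apply: NNPP => f0.
have [s def_f] := Lf (size (f : {poly mpoly C k'.+1})).
have s0 : (s : {poly mpoly C k'.+1}) != 0.
  by apply/eqP => s0; apply: f0; rewrite def_f s0 mulr0.
have: size (f : {poly mpoly C k'.+1}) =
  size ((('X : {poly mpoly C k'.+1}) - (c%:R * mvar C k'.+1 k')%:P)
    ^+ size (f : {poly mpoly C k'.+1}) * (s : {poly mpoly C k'.+1})).
  by rewrite {1}def_f.
rewrite size_monicM ?monic_exp ?monicXsubC // size_exp_XsubC addSn /=.
by move/eqP; rewrite -[X in X == _]addn0 eqn_add2l eq_sym size_poly_eq0 (negPf s0).
Qed.

Definition restrict (f : mpoly C k) : mpoly C k'.+1 :=
  (f : {poly mpoly C k'.+1}).[c%:R * mvar C k'.+1 k'].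

Lemma form_idealP f : form_ideal 1 f <-> restrict f = 0.
Proof.
split=> [[s ->]|/eqP/factor_theorem[s ->]]; last by exists s; rewrite expr1 mulrC.
by rewrite /restrict [LHS]hornerM hornerD hornerN hornerX hornerC subrr mul0r.
Qed.

(** Modulo the form one gets a polynomial ring in one variable fewer, a domain. A point where the
    product of the restrictions is nonzero is completed by the last coordinate that the form
    prescribes. *)
Lemma form_ideal_nonvanish (f g : mpoly C k) :
    ~ form_ideal 1 f -> ~ form_ideal 1 g ->
  exists w, [/\ w k'.+1 = c%:R * w k', ev w k f != 0 & ev w k g != 0].
Proof.
rewrite !form_idealP => f0 g0.
have [w] := mpoly_nonvanish (mpoly_mul_neq0 f0 g0).
rewrite rmorphM mulf_eq0 negb_or => /andP[wf wg].
pose w' := upd w k'.+1 (c%:R * w k').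
have restrictE (h : mpoly C k) : ev w' k h = ev w k'.+1 (restrict h).
  rewrite ev_updS /restrict -horner_map rmorphM rmorph_nat mev_var //.
exists w'; rewrite !restrictE; split=> //.
by rewrite /w' /upd eqxx ltn_eqF.
Qed.

End RootForm.

(** * Coprimality under a reflection *)

Section Reflection.
Variables (C : numClosedFieldType) (a m k' : nat).
Hypotheses (a_gt0 : (0 < a)%N) (m_gt0 : (0 < m)%N).
Implicit Type w : nat -> C.
Notation k := k'.+2.
Notation n := (m + k)%N.
Notation ev w n := (mev (idfun : {rmorphism C -> C}) w n).

Definition psum_ideal := in_ideal_gen (fun i : 'I_m => psum C n (i.+1 * a)%N).

Lemma ideal_psum : ideal psum_ideal.
Proof. exact: ideal_in_gen. Qed.

Lemma psum_in_ideal i : (0 < i <= m)%N -> psum_ideal (psum C n (i * a)).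
Proof.
case: i => // i lt_im.
exact: (gen_in_ideal (fun i : 'I_m => psum C n (i.+1 * a)%N) (Ordinal lt_im)).
Qed.

Lemma psum_ideal_tower (Q : mpoly C k -> Prop) f :
  ideal Q -> psum_ideal f -> tower a m Q (d := m) f.
Proof.
move=> idQ; apply: in_gen_sub; first exact: ideal_tower.
by move=> i; apply: (tower_psum a_gt0 idQ); exact: ltn_ord.
Qed.

Lemma tower_psum_ideal f :
  tower a m (fun x : mpoly C k => x = 0) (d := m) f -> psum_ideal f.
Proof.
apply: tower_sub => //; [exact: ideal_psum | exact: psum_in_ideal |].
by move=> q ->; rewrite rmorph0; apply: ideal_zero ideal_psum.
Qed.

Section Form.
Variable c : bool.

Let L : mpoly C n := embed C m k k (root_form C k' c).

Lemma psum_ideal_regular f : psum_ideal (L * f) -> psum_ideal f.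
Proof.
move=> Lf; apply: tower_psum_ideal.
apply: (tower_regular a_gt0 (ideal_eq0 _) (c := root_form C k' c)).
  exact: root_form_regular.
by rewrite -embed_up; apply: psum_ideal_tower => //; apply: ideal_eq0.
Qed.

Lemma tower_form_ideal j f :
  tower a m (form_ideal (C := C) (k' := k') c j) (d := m) f ->
  exists i s, psum_ideal i /\ f = i + L ^+ j * s.
Proof.
have idI := ideal_psum.
apply: (tower_sub a_gt0 (P := fun f => exists i s, psum_ideal i /\ f = i + L ^+ j * s)).
- split.
  + by exists 0, 0; split; [apply: ideal_zero|rewrite mulr0 addr0].
  + move=> x y [i [s [Ii ->]]] [i' [s' [Ii' ->]]]; exists (i + i'), (s + s').
    by split; [apply: ideal_add|rewrite mulrDr addrACA].
  + move=> x y [i [s [Ii ->]]]; exists (x * i), (x * s).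
    by split; [apply: ideal_mul|rewrite mulrDr; congr (_ + _); rewrite mulrCA].
- by move=> i /psum_in_ideal Ii; exists (psum C n (i * a)), 0; rewrite mulr0 addr0.
- move=> q [s ->]; exists 0, (embed C m k k s); split; first exact: ideal_zero.
  by rewrite add0r rmorphM rmorphXn.
Qed.

Lemma form_ideal_tower j i s : psum_ideal i ->
  tower a m (form_ideal (C := C) (k' := k') c j) (d := m) (i + L ^+ j * s).
Proof.
have idQ := ideal_form C k' c j; have idT := ideal_tower a m idQ m.
move=> Ii; apply: (ideal_add idT); first exact: psum_ideal_tower.
apply: (ideal_mulr idT); rewrite /L -rmorphXn embed_up; apply: tower_up => //.
by exists 1; rewrite mulr1.
Qed.

(** Otherwise there is a base point on the hyperplane where neither [branch] nor the [D] of the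
    interpolation vanishes. Then [u] is nonzero at some point of its fibre, where [u * u]
    vanishes. *)
Lemma tower_form_radical u :
  tower a m (form_ideal (C := C) (k' := k') c 1) (d := m) (u * u) ->
  tower a m (form_ideal (C := C) (k' := k') c 1) (d := m) u.
Proof.
move=> Tuu; apply: NNPP => Tu.
have [D [QD DP]] := tower_interpolation a_gt0 (ideal_form C k' c 1) (leqnn m) Tu.
have Qb : ~ form_ideal c 1 (branch C a m k').
  case=> s def_b; have := branch_base_point C k' a_gt0 m_gt0 c.
  rewrite def_b expr1 rmorphM ev_root_form /base_point !eqxx.
  by rewrite [k'.+1 == k']gtn_eqF // mulr1 subrr mul0r eqxx.
have [w [wL wD wb]] := form_ideal_nonvanish QD Qb.
have [w' [eq_w Vw]] := DP w wD (branch_separable a_gt0 m_gt0 wb).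
case/eqP; apply/eqP; rewrite -[_ == 0]orbb -mulf_eq0 -rmorphM; apply/eqP.
apply: (tower_vanish _ Vw Tuu) => q [s ->].
by rewrite expr1 rmorphM ev_root_form !eq_w // wL subrr mul0r.
Qed.

Variables (sigma : {rmorphism mpoly C n -> mpoly C n}) (e : mpoly C n).
Hypotheses (sigma_ideal : forall f, psum_ideal f -> psum_ideal (sigma f))
  (sigma_L : sigma L = e * L) (e_unit : exists e', e' * e = 1)
  (sigma_sub : forall f, exists s, f - sigma f = L * s).

(** Radicality applies to [u * u = u * sigma u + u * (u - sigma u)]. Modulo the ideal, [u * sigma u]
    is then [e * L ^+ 2 * (v * sigma v)], where the unit [e] and the regular [L] can be
    cancelled. *)
Lemma reflection_form_descent u : psum_ideal (u * sigma u) ->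
  exists i v, [/\ psum_ideal i, u = i + L * v & psum_ideal (v * sigma v)].
Proof.
have idI := ideal_psum; move=> Iu.
have [i [v [Ii def_u]]] : exists i v, psum_ideal i /\ u = i + L ^+ 1 * v.
  apply: tower_form_ideal; apply: tower_form_radical.
  have [s def_s] := sigma_sub u.
  have -> : u * u = u * sigma u + L ^+ 1 * (s * u).
    by rewrite expr1 mulrA -def_s; ring.
  exact: form_ideal_tower.
rewrite expr1 in def_u; exists i, v; split=> //.
have [e' e'e] := e_unit.
have : psum_ideal (L * (L * (v * sigma v))).
  have -> : L * (L * (v * sigma v)) =
      e' * (u * sigma u - (i * sigma u + L * v * sigma i)).
    rewrite def_u rmorphD rmorphM sigma_L.
    transitivity ((e' * e) * (L * (L * (v * sigma v)))); first by rewrite e'e mul1r.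
    ring.
  apply: (ideal_mul idI); apply: (ideal_sub idI) => //; apply: (ideal_add idI).
    exact: (ideal_mulr idI).
  by apply: (ideal_mul idI); apply: sigma_ideal.
by move/psum_ideal_regular/psum_ideal_regular.
Qed.

Lemma reflection_coprime u : psum_ideal (u * sigma u) -> psum_ideal u.
Proof.
have idI := ideal_psum.
have powL j u' : psum_ideal (u' * sigma u') ->
    exists i s, psum_ideal i /\ u' = i + L ^+ j * s.
  elim: j u' => [|j IHj] u' Iu'.
    by exists 0, u'; split; [apply: ideal_zero|rewrite add0r mul1r].
  have [i [v [Ii -> /IHj[i' [s [Ii' ->]]]]]] := reflection_form_descent Iu'.
  exists (i + L * i'), s; split; last by rewrite exprS; ring.
  by apply: (ideal_add idI) => //; apply: (ideal_mul idI).
move=> Iu; apply: tower_psum_ideal.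
apply: (tower_separated a_gt0 (Qs := form_ideal (C := C) (k' := k') c)).
- exact: ideal_form.
- exact: form_ideal_separated.
- by move=> j; have [i [s [Ii ->]]] := powL j u Iu; apply: form_ideal_tower.
Qed.

End Form.

End Reflection.

(** * Transpositions and scalings of the variables *)

Definition transp (i j l : nat) := if l == i then j else if l == j then i else l.

Lemma transpK i j : involutive (transp i j).
Proof.
move=> l; rewrite /transp; have [->|li] := eqVneq l i.
  by rewrite eqxx; case: eqVneq.
by have [->|lj] := eqVneq l j; rewrite ?eqxx // (negPf li) (negPf lj).
Qed.

Lemma transp_lt i j l n : (i < n)%N -> (j < n)%N -> (l < n)%N -> (transp i j l < n)%N.
Proof. by rewrite /transp; case: ifP => // _; case: ifP. Qed.

Lemma sum_transp (V : nmodType) n i j (F : nat -> V) : (i < n)%N -> (j < n)%N ->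
  \sum_(l < n) F (transp i j l) = \sum_(l < n) F l.
Proof.
move=> lt_i lt_j; set I := Ordinal lt_i; set J := Ordinal lt_j.
rewrite [RHS](reindex_inj (@perm_inj _ (tperm I J))); apply: eq_bigr => l _.
congr F; rewrite /transp; case: tpermP => [->|->|]; rewrite ?eqxx //=.
  by case: eqP.
move=> /eqP/negPf lI /eqP/negPf lJ.
by rewrite -[nat_of_ord l == i]/(l == I) -[nat_of_ord l == j]/(l == J) lI lJ.
Qed.

Section MonomialReflections.
Variables (C : numClosedFieldType) (a m k' : nat).
Hypotheses (a_gt0 : (0 < a)%N) (m_gt0 : (0 < m)%N).
Implicit Type w : nat -> C.
Notation k := k'.+2.
Notation n := (m + k)%N.
Notation ev w n := (mev (idfun : {rmorphism C -> C}) w n).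
Notation I := (@psum_ideal C a m k').

Inductive reflection := Swap of nat & nat | Scale of nat & C.

(** The parameter [iota] lets the same formula move points, with [R = C], and the family of
    variables, with [R] the polynomial ring. *)
Definition act (R : comNzRingType) (iota : {rmorphism C -> R}) (t : reflection)
    (s : nat -> R) : nat -> R :=
  match t with
  | Swap i j => fun l => s (transp i j l)
  | Scale j z => fun l => if l == j then iota z * s l else s l
  end.

Definition valid t :=
  match t with
  | Swap i j => (i < n)%N && (j < n)%N
  | Scale j z => (j < n)%N && (z ^+ a == 1)
  end.

Definition subst t : {rmorphism mpoly C n -> mpoly C n} :=
  mev (mcst C n) (act (mcst C n) t (mvar C n)) n.

Lemma subst_var t l : (l < n)%N ->
  subst t (mvar C n l) = act (mcst C n) t (mvar C n) l.
Proof. exact: mev_var. Qed.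

Lemma subst_cst t c : subst t (mcst C n c) = mcst C n c.
Proof. exact: mev_cst. Qed.

Lemma ev_subst t w f : valid t ->
  ev w n (subst t f) = ev (act (idfun : {rmorphism C -> C}) t w) n f.
Proof.
move=> val_t; move: f.
apply: (@mpoly_morph_ext C C n (ev w n \o subst t)) => [c|l lt_l].
  by rewrite [LHS]/= subst_cst !mev_cst.
rewrite [LHS]/= subst_var // mev_var //.
case: t val_t => [i j /andP[lt_i lt_j]|j z _] /=.
  by rewrite mev_var // transp_lt.
by case: eqP => _; rewrite ?rmorphM mev_var ?mev_cst.
Qed.

Lemma subst_psum t r : valid t -> subst t (psum C n (r * a)) = psum C n (r * a).
Proof.
move=> val_t; rewrite /psum rmorph_sum.
case: t val_t => [i j /andP[lt_i lt_j]|j z /andP[lt_j /eqP za]].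
  rewrite -[RHS](sum_transp (fun l => mvar C n l ^+ (r * a)) lt_i lt_j).
  by apply: eq_bigr => l _; rewrite rmorphXn subst_var.
apply: eq_bigr => l _; rewrite rmorphXn subst_var //=; case: eqP => // _.
by rewrite exprMn -rmorphXn mulnC exprM za expr1n rmorph1 mul1r.
Qed.

Lemma subst_ideal t f : valid t -> I f -> I (subst t f).
Proof.
move=> val_t [r ->]; rewrite rmorph_sum; apply: (ideal_sum (ideal_psum _ _ _ _)).
move=> i _; rewrite rmorphM subst_psum //.
exact: (ideal_mul (ideal_psum _ _ _ _)) (gen_in_ideal _ i).
Qed.

Definition good t := valid t /\ forall u, I (u * subst t u) -> I u.

Lemma base_reflection (c : bool) t (e e' : mpoly C n) :
    let L : mpoly C n := mvar C n k'.+1 - c%:R * mvar C n k' in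
    valid t -> subst t L = e * L -> e' * e = 1 ->
    (forall l, (l < n)%N -> exists s, mvar C n l - subst t (mvar C n l) = L * s) ->
  good t.
Proof.
move=> L val_t tL e'e var_t; split=> // u.
have LE : embed C m k k (root_form C k' c) = L.
  by rewrite root_formE rmorphB rmorphM rmorph_nat /embed !mev_var.
apply: (reflection_coprime a_gt0 m_gt0 (c := c)); rewrite ?LE.
- by move=> f; apply: subst_ideal.
- exact: tL.
- by exists e'.
have idL : ideal (fun f : mpoly C n => exists s, f = L * s).
  split=> [|x y [s ->] [s' ->]|x y [s ->]]; first by exists 0; rewrite mulr0.
    by exists (s + s'); rewrite mulrDr.
  by exists (x * s); rewrite mulrCA.
apply: (@mpoly_morph_cong C _ n idfun (subst t) _ idL) => // c'.
by rewrite subst_cst.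
Qed.

Lemma good_base_swap : good (Swap k' k'.+1).
Proof.
have lt1 : (k'.+1 < n)%N by lia.
have lt0 : (k' < n)%N by lia.
have ne : (k'.+1 == k') = false by rewrite gtn_eqF.
apply: (@base_reflection true _ (-1) (-1)) => /=.
- by rewrite lt0 lt1.
- rewrite rmorphB rmorphM rmorph_nat !subst_var //= /transp eqxx ne eqxx; ring.
- by rewrite mulrNN mulr1.
move=> l lt_l; rewrite subst_var //= /transp.
have [->|_] := eqVneq l k'; first by exists (-1); ring.
have [->|_] := eqVneq l k'.+1; first by exists 1; ring.
by exists 0; rewrite subrr mulr0.
Qed.

Lemma good_base_scale z : z ^+ a = 1 -> good (Scale k'.+1 z).
Proof.
move=> za; have lt1 : (k'.+1 < n)%N by lia.
have z0 : z != 0.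
  by apply: contra_eq_neq za => ->; rewrite expr0n eqn0Ngt a_gt0 eq_sym oner_eq0.
apply: (@base_reflection false _ (mcst C n z) (mcst C n z^-1)) => /=.
- by rewrite lt1 za /=.
- by rewrite mul0r subr0 subst_var //= eqxx.
- by rewrite -rmorphM mulVf // rmorph1.
move=> l lt_l; rewrite subst_var //= mul0r subr0.
case: eqP => [->|_]; last by exists 0; rewrite subrr mulr0.
by exists (1 - mcst C n z); ring.
Qed.

Definition conj_reflection i j t :=
  match t with
  | Swap p q => Swap (transp i j p) (transp i j q)
  | Scale p z => Scale (transp i j p) z
  end.

Lemma transp_conj i j p q l :
  transp i j (transp p q (transp i j l)) = transp (transp i j p) (transp i j q) l.
Proof.
rewrite {2 4}/transp.
have inj x : (transp i j l == x) = (l == transp i j x).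
  by rewrite -(inj_eq (inv_inj (transpK i j))) transpK.
by rewrite !inj; do ![case: ifP => _]; rewrite ?transpK.
Qed.

Lemma subst_conj i j t : (i < n)%N -> (j < n)%N -> valid t ->
  subst (Swap i j) \o (subst t \o subst (Swap i j)) =1 subst (conj_reflection i j t).
Proof.
move=> lt_i lt_j val_t.
apply: (@mpoly_morph_ext C _ n (subst (Swap i j) \o (subst t \o subst (Swap i j)))).
  by move=> c; rewrite [LHS]/= !subst_cst.
move=> l lt_l; have lt_tl : (transp i j l < n)%N by apply: transp_lt.
rewrite [LHS]/= [subst (Swap i j) (mvar _ _ _)]subst_var // [act _ _ _ _]/=.
rewrite [subst t _]subst_var // [RHS]subst_var //.
case: t val_t => [p q /andP[lt_p lt_q]|p z _] /=.
  by rewrite subst_var ?transp_lt //= transp_conj.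
have -> : (transp i j l == p) = (l == transp i j p).
  by rewrite -(inj_eq (inv_inj (transpK i j))) transpK.
by case: ifP => _; rewrite ?rmorphM ?subst_cst subst_var //= transpK.
Qed.

(** Let [s] be the swap, an involution preserving the ideal. Applying [s] to [u * s (t (s u))] gives
    [v * t v] with [v = s u]. *)
Lemma good_conj i j t : (i < n)%N -> (j < n)%N -> good t ->
  good (conj_reflection i j t).
Proof.
move=> lt_i lt_j [val_t good_t].
have val_s : valid (Swap i j) by rewrite /= lt_i.
have sK : subst (Swap i j) \o subst (Swap i j) =1 id.
  apply: (@mpoly_morph_ext C _ n (subst (Swap i j) \o subst (Swap i j)) idfun).
    by move=> c; rewrite [LHS]/= !subst_cst.
  move=> l lt_l; rewrite [LHS]/= subst_var //= subst_var ?transp_lt //=.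
  by rewrite transpK.
split.
  case: t val_t {good_t} => [p q|p z] /= /andP[lt_p pq]; first by rewrite !transp_lt.
  by rewrite transp_lt.
move=> u Iu; rewrite -[u]sK; apply: subst_ideal => //; apply: good_t.
have := subst_ideal val_s Iu; rewrite rmorphM -subst_conj //.
by rewrite -[X in _ * X]/((subst (Swap i j) \o subst (Swap i j)) _) sK.
Qed.

Lemma good_swap i j : (k <= i < n)%N -> (k <= j < n)%N -> i != j -> good (Swap i j).
Proof.
move=> /andP[le_i lt_i] /andP[le_j lt_j] ne_ij.
have lt0 : (k' < n)%N by lia.
have lt1 : (k'.+1 < n)%N by lia.
(* Conjugation carries [k'] to [i], then [k'.+1] to [j]; the two steps do not interfere, as [i] and
   [j] are distinct and outside the base. *)
have := good_conj lt1 lt_j (good_conj lt0 lt_i good_base_swap).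
rewrite /= {2}/transp eqxx {3}/transp gtn_eqF // ltn_eqF //.
rewrite {2}/transp eqxx /transp (negPf ne_ij) gtn_eqF //.
Qed.

Lemma good_scale j z : (k <= j < n)%N -> z ^+ a = 1 -> good (Scale j z).
Proof.
move=> /andP[le_j lt_j] za; have lt1 : (k'.+1 < n)%N by lia.
by have := good_conj lt1 lt_j (good_base_scale za); rewrite /= /transp eqxx.
Qed.

(** * Transitivity on the fibres *)

(* [reach L w w']: some subword of [L] carries [w] to [w']. *)
Fixpoint reach (L : seq reflection) w w' : Prop :=
  if L is t :: L' then
    reach L' w w' \/ reach L' (act (idfun : {rmorphism C -> C}) t w) w'
  else w = w'.

Fixpoint all_good L := if L is t :: L' then good t /\ all_good L' else True.

Lemma reach_refl L w : reach L w w.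
Proof. by elim: L => //= t L IHL; left. Qed.

Lemma reach_cat L1 L2 w w1 w2 :
  reach L1 w w1 -> reach L2 w1 w2 -> reach (L1 ++ L2) w w2.
Proof.
elim: L1 w => [w /= -> //|t L1 IHL w /= [r1|r1] r2]; [left|right]; exact: IHL.
Qed.

Lemma reach_map (T : eqType) (f : T -> reflection) s x w : x \in s ->
  reach (map f s) w (act (idfun : {rmorphism C -> C}) (f x) w).
Proof.
elim: s => //= y s IHs; rewrite in_cons => /predU1P[<-|s_x].
  by right; apply: reach_refl.
by left; apply: IHs.
Qed.

Lemma all_good_cat L1 L2 : all_good L1 -> all_good L2 -> all_good (L1 ++ L2).
Proof. by elim: L1 => //= t L1 IHL [gt gL1] gL2; split=> //; apply: IHL. Qed.

Lemma all_good_map (T : eqType) (f : T -> reflection) s :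
  (forall x, x \in s -> good (f x)) -> all_good (map f s).
Proof.
elim: s => //= y s IHs gs; split; first by apply: gs; rewrite mem_head.
by apply: IHs => x s_x; apply: gs; rewrite in_cons s_x orbT.
Qed.

(* The product of the translates of [u] under the subwords of [L] is not in
   the ideal either. *)
Lemma orbit_product L u : all_good L -> ~ I u ->
  exists v, ~ I v /\ forall w w', reach L w w' -> ev w n v != 0 -> ev w' n u != 0.
Proof.
elim: L => [_ Iu|t L IHL [[val_t good_t] gL] Iu].
  by exists u; split=> // w w' ->.
have [v [Iv vP]] := IHL gL Iu.
exists (v * subst t v); split; first by move/good_t.
move=> w w' + ; rewrite rmorphM mulf_eq0 negb_or => r /andP[wv].
by rewrite ev_subst // => twv; case: r => r; apply: vP r _.
Qed.

Lemma unity_roots : exists rs : seq C, forall z, (z \in rs) = (z ^+ a == 1).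
Proof.
have [rs eq_rs] := closed_field_poly_normal ('X^a - 1 : {poly C}).
exists rs => z; rewrite -root_prod_XsubC.
have := monicP (monicXnsubC (1 : C) a_gt0); rewrite polyC1 => lc1.
move: eq_rs; rewrite lc1 scale1r => <-.
by rewrite rootE !hornerE subr_eq0.
Qed.

(** A selection sort as a word: for each position [j] in turn, the swaps that may bring the right
    [y_j] there, then the scalings that may correct [x_j]. *)
Fixpoint fibre_word (rs : seq C) j d : seq reflection :=
  if d is d'.+1 then
    map (Swap j) (iota j.+1 d') ++ map (Scale j) rs ++ fibre_word rs j.+1 d'
  else [::].

Lemma fibre_word_good rs j d : (forall z, (z \in rs) = (z ^+ a == 1)) ->
  (k <= j)%N -> (j + d)%N = n -> all_good (fibre_word rs j d).
Proof.
move=> rsP; elim: d j => //= d IHd j le_kj eq_jd; apply: all_good_cat.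
  by apply: all_good_map => i; rewrite mem_iota => lt_i; apply: good_swap; lia.
apply: all_good_cat; last by apply: IHd; lia.
by apply: all_good_map => z; rewrite rsP => /eqP za; apply: good_scale => //; lia.
Qed.

Lemma fibre_word_reach rs j d w w' : (forall z, (z \in rs) = (z ^+ a == 1)) ->
    (forall i, (i < j)%N -> w i = w' i) ->
    perm_eq (map (wpow a w) (iota j d)) (map (wpow a w') (iota j d)) ->
  exists w1, reach (fibre_word rs j d) w w1 /\ forall i, (i < j + d)%N -> w1 i = w' i.
Proof.
move=> rsP; elim: d j w => [|d IHd] j w eq_w perm_w.
  by exists w; split=> // i; rewrite addn0; apply: eq_w.
have [w1 [r1 eq_w1 perm_w1 w1j]] : exists w1,
    [/\ reach (map (Swap j) (iota j.+1 d)) w w1, forall i, (i < j)%N -> w1 i = w' i,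
        perm_eq (map (wpow a w1) (iota j d.+1)) (map (wpow a w') (iota j d.+1))
      & wpow a w1 j = wpow a w' j].
  have : wpow a w' j \in map (wpow a w) (iota j d.+1).
    by rewrite (perm_mem perm_w) map_f // mem_head.
  case/mapP => i; rewrite [iota _ _]/= in_cons => /predU1P[->|i_in] eq_i.
    by exists w; split=> //; apply: reach_refl.
  have lt_ji : (j < i < j.+1 + d)%N by move: i_in; rewrite mem_iota.
  exists (act (idfun : {rmorphism C -> C}) (Swap j i) w); split.
  - exact: reach_map.
  - by move=> l lt_l; rewrite /= /transp !ltn_eqF ?eq_w //; lia.
  - rewrite -(permPr perm_w) (map_comp (wpow a w) (transp j i)) perm_map //.
    rewrite -[j :: _]/(iota j d.+1).
    apply: uniq_perm; rewrite ?(map_inj_uniq (inv_inj (transpK j i))) ?iota_uniq //.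
    move=> l; rewrite -{1}(transpK j i l) mem_map; last exact: inv_inj (transpK j i).
    by rewrite !mem_iota /transp; case: eqP => [->|_]; [|case: eqP => [->|_]]; lia.
  - by rewrite /wpow /= /transp eqxx.
have [w2 [r2 eq_w2 eq_y]] : exists w2,
    [/\ reach (map (Scale j) rs) w1 w2, forall i, (i < j.+1)%N -> w2 i = w' i
      & forall i, wpow a w2 i = wpow a w1 i].
  (* If [w1 j] is zero so is [w' j], their [a]-th powers being equal; otherwise their quotient is an
     [a]-th root of unity. *)
  have [w1j0|w1j0] := eqVneq (w1 j) 0.
    exists w1; split=> // [|i]; first exact: reach_refl.
    rewrite ltnS leq_eqVlt => /predU1P[->|]; last exact: eq_w1.
    move/esym/eqP: w1j; rewrite /wpow w1j0 expr0n eqn0Ngt a_gt0 expf_eq0 a_gt0 /=.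
    by move/eqP->.
  pose z := w' j / w1 j.
  have za : z ^+ a = 1.
    by rewrite expr_div_n -[w' j ^+ a]w1j divff // expf_neq0.
  exists (act (idfun : {rmorphism C -> C}) (Scale j z) w1); split.
  - by apply: reach_map; rewrite rsP za.
  - move=> i; rewrite ltnS leq_eqVlt /= => /predU1P[->|lt_i].
      by rewrite eqxx /z divfK.
    by rewrite (ltn_eqF lt_i) eq_w1.
  - by move=> i; rewrite /wpow /=; case: eqP => // _; rewrite exprMn za mul1r.
have [|w3 [r3 eq_w3]] := IHd j.+1 w2 eq_w2.
  rewrite (eq_map eq_y); move: perm_w1.
  by rewrite /= w1j perm_cons.
exists w3; split; last by move=> i; rewrite -addSnnS; apply: eq_w3.
exact: reach_cat r1 (reach_cat r2 r3).
Qed.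

(** * Primality *)

Lemma psum_ideal_vanish w f : on_tower a m k w m -> I f -> ev w n f = 0.
Proof.
move=> Vw If; apply: (tower_vanish (Q := fun x => x = 0) _ Vw) => [q ->|].
  exact: rmorph0.
exact: (psum_ideal_tower a_gt0 (ideal_eq0 _)).
Qed.

Lemma psum_ideal_prime : prime_ideal I.
Proof.
have idI := ideal_psum C a m k'.
split; [exact: ideal_zero|exact: ideal_add|exact: ideal_mul| |].
  (* Properness: the tower has a point over the origin, where 1 would have to vanish. *)
  move=> I1; have [w [_ Vw]] := on_tower_exists k a_gt0 (fun=> 0 : C) (leqnn m).
  by have /eqP := psum_ideal_vanish Vw I1; rewrite rmorph1 oner_eq0.
move=> u v Iuv; apply: NNPP => /not_or_and[Iu Iv].
have [rs rsP] := unity_roots.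
have nE : (k + m)%N = n by rewrite addnC.
have [u' [Iu' u'P]] := orbit_product (fibre_word_good rsP (leqnn k) nE) Iu.
have nT f : ~ I f -> ~ tower a m (fun x : mpoly C k => x = 0) (d := m) f.
  by move=> If Tf; apply: If; apply: tower_psum_ideal.
have [Du [Du0 DuP]] := tower_interpolation a_gt0 (ideal_eq0 _) (leqnn m) (nT _ Iu').
have [Dv [Dv0 DvP]] := tower_interpolation a_gt0 (ideal_eq0 _) (leqnn m) (nT _ Iv).
have branch0 : branch C a m k' <> 0.
  move=> b0; have := branch_base_point C k' a_gt0 m_gt0 true.
  by rewrite b0 rmorph0 eqxx.
(* Choose a base point generic for [u'], for [v] and for the separability of the fibre
   polynomial. *)
have [w] := mpoly_nonvanish (mpoly_mul_neq0 (mpoly_mul_neq0 Du0 Dv0) branch0).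
rewrite !rmorphM !mulf_eq0 !negb_or -andbA => /and3P[wDu wDv].
move/(branch_separable a_gt0 m_gt0) => sep_w.
have [w1 [eq_w1 Vw1 u'w1]] := DuP w wDu sep_w.
have [w2 [eq_w2 Vw2 vw2]] := DvP w wDv sep_w.
have eq_w12 i : (i < k)%N -> w1 i = w2 i by move=> lt_ik; rewrite eq_w1 ?eq_w2.
(* The [y_i] of [w1] and of [w2] on the fibre are the roots of one polynomial, hence agree up to
   order, so [w1] is carried to a point with the first [n] coordinates of [w2]. *)
have [|w3 [r3 eq_w3]] := fibre_word_reach (j := k) (d := m) rsP eq_w12.
  apply: prod_XsubC_eq; rewrite -[LHS](fibre_polyE a_gt0 'X Vw1).
  by rewrite -[RHS](fibre_polyE a_gt0 'X Vw2) (eq_fibre_poly a m 'X eq_w12).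
have uw2 : ev w2 n u != 0.
  rewrite -(eq_mev _ (s1 := w3)) ?(u'P _ _ r3) // => i.
  by rewrite addnC; apply: eq_w3.
have /eqP := psum_ideal_vanish Vw2 Iuv.
by rewrite rmorphM mulf_eq0 (negPf uw2) (negPf vw2).
Qed.

End MonomialReflections.

(* C plays the role of the complex numbers (any algebraically closed
   numeric field, e.g. algC); I = < p_a, p_{2a}, ..., p_{ma} >. *)
Theorem theorem3p12 (C : numClosedFieldType) (n a m : nat) :
  (3 <= n)%N -> (0 < a)%N -> (0 < m)%N -> (m < n.-1)%N ->
  prime_ideal (in_ideal_gen (fun i : 'I_m => psum C n (i.+1 * a)%N)).
Proof.
move=> _ a_gt0 m_gt0 lt_mn.
(* As [k = n - m] is at least 2, it has the form [k'.+2], which leaves two base variables for the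
   reflections. *)
have -> : n = (m + (n - m).-2.+2)%N by lia.
exact: psum_ideal_prime.
Qed.
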